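(* Let $R$ be a ring. Then $R$ is uniquely D-nil-clean if and only if $R$ is a D-ring, or the following three conditions all hold: (1) $R$ is abelian; (2) $R$ is periodic; (3) $R/J(R)$ is Boolean.
   Context: All rings are associative with identity, not necessarily commutative. $J(R)$ is the Jacobson radical of $R$. An element $a\in R$ is a zero-divisor if there exist nonzero $b,c\in R$ with $ab=0=ca$. An element $a\in R$ is uniquely nil-clean if it can be written in exactly one way as the sum of a nilpotent element and an idempotent of $R$. $R$ is uniquely D-nil-clean if every zero-divisor in $R$ is uniquely nil-clean. $R$ is a D-ring if every zero-divisor in $R$ is nilpotent. $R$ is abelian if every idempotent of $R$ is central. $R$ is periodic if for any $a\in R$ there exist distinct $m,n\in\mathbb{N}$ with $a^m=a^n$. A ring is Boolean if every element is an idempotent. *)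

(* Defs.v *)
From HB Require Import structures.
From mathcomp Require Import all_boot all_algebra.
From mathcomp Require Import boolp classical_sets.

Set Implicit Arguments.
Unset Strict Implicit.
Unset Printing Implicit Defensive.

Import GRing.Theory.
Local Open Scope ring_scope.
Local Open Scope quotient_scope.
Local Open Scope classical_set_scope.

(* Rings are [pzRingType]s: associative, unital, possibly noncommutative, and
   possibly zero. *)

Section Elements.
Variable R : pzRingType.

Definition idempotent_elem (e : R) : Prop := e * e = e.

Definition nilpotent_elem (a : R) : Prop := exists n : nat, a ^+ n = 0.

Definition zero_divisor (a : R) : Prop :=
  exists b c : R, [/\ b != 0, c != 0, a * b = 0 & c * a = 0].

Definition uniquely_nil_clean (a : R) : Prop :=
  exists! p : R * R,
    [/\ nilpotent_elem p.1, idempotent_elem p.2 & a = p.1 + p.2].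

End Elements.

Section Rings.
Variable R : pzRingType.

Definition uniquely_D_nil_clean : Prop :=
  forall a : R, zero_divisor a -> uniquely_nil_clean a.

Definition D_ring : Prop := forall a : R, zero_divisor a -> nilpotent_elem a.

Definition abelian_ring : Prop :=
  forall e : R, idempotent_elem e -> forall x : R, GRing.comm e x.

(* Allowing the exponent 0 is harmless: if [a ^+ 0 = a ^+ n] with [0 < n], then
   [a ^+ 1 = a ^+ n.+1]. *)
Definition periodic_ring : Prop :=
  forall a : R, exists m n : nat, m <> n /\ a ^+ m = a ^+ n.

Definition boolean_ring : Prop := forall a : R, idempotent_elem a.

End Rings.

Section JacobsonRadical.
Variable R : pzRingType.

Definition left_ideal (I : set R) : Prop :=
  [/\ I 0, forall x y, I x -> I y -> I (x + y) & forall a x, I x -> I (a * x)].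

Definition maximal_left_ideal (M : set R) : Prop :=
  [/\ left_ideal M, M <> setT &
      forall I : set R, left_ideal I -> M `<=` I -> I = M \/ I = setT].

Definition jacobson : set R :=
  \bigcap_(M in [set M | maximal_left_ideal M]) M.

Definition in_jacobson : {pred R} := fun x => x \in jacobson.

Lemma in_jacobsonP x :
  reflect (forall M, maximal_left_ideal M -> M x) (x \in in_jacobson).
Proof. by apply: (iffP idP) => [/set_mem | Jx]; last exact: mem_set. Qed.

Lemma jacobson_zmod_closed : zmod_closed in_jacobson.
Proof.
split; first by apply/in_jacobsonP => M [[]].
move=> x y /in_jacobsonP Jx /in_jacobsonP Jy; apply/in_jacobsonP => M maxM.
have [[_ MD MM] _ _] := maxM.
by rewrite -mulN1r; apply: MD; [exact: Jx | apply: MM; exact: Jy].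
Qed.

HB.instance Definition _ :=
  GRing.isZmodClosed.Build R in_jacobson jacobson_zmod_closed.

Lemma jacobsonMl a x : x \in in_jacobson -> a * x \in in_jacobson.
Proof.
move=> /in_jacobsonP Jx; apply/in_jacobsonP => M maxM.
by have [[_ _ MM] _ _] := maxM; apply: MM; exact: Jx.
Qed.

(* For [M] a maximal left ideal, [(M : a) = {x | x * a \in M}] is either the
   whole ring or again a maximal left ideal. *)
Lemma jacobsonMr a x : x \in in_jacobson -> x * a \in in_jacobson.
Proof.
move=> /in_jacobsonP Jx; apply/in_jacobsonP => M maxM.
have [[M0 MD MM] _ Mmax] := maxM.
have [Ma | nMa] := pselect (M a); first exact: MM.
suff /Jx : maximal_left_ideal [set y | M (y * a)] by [].
split.
- split=> /=; first by rewrite mul0r.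
  + by move=> y z My Mz; rewrite mulrDl; exact: MD.
  + by move=> b y My; rewrite -mulrA; exact: MM.
- by move=> /seteqP[_ /(_ 1 I)] /=; rewrite mul1r.
move=> I [I0 ID IM] MaI.
pose N := [set z | exists2 m, M m & exists2 i, I i & z = m + i * a].
have idN : left_ideal N.
  split; first by exists 0 => //; exists 0 => //; rewrite mul0r addr0.
  + move=> _ _ [m Mm [i Ii ->]] [m' Mm' [i' Ii' ->]].
    exists (m + m'); first exact: MD.
    by exists (i + i'); [exact: ID | rewrite mulrDl addrACA].
  + move=> b _ [m Mm [i Ii ->]]; exists (b * m); first exact: MM.
    by exists (b * i); [exact: IM | rewrite mulrDr mulrA].
have MN : M `<=` N.
  by move=> m Mm; exists m => //; exists 0 => //; rewrite mul0r addr0.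
have [NM | NT] := Mmax N idN MN; [left | right].
- apply/seteqP; split=> // i Ii /=; rewrite -NM.
  by exists 0 => //; exists i => //; rewrite add0r.
- apply/seteqP; split=> // y _.
  have [m Mm [i Ii ya]] : N (y * a) by rewrite NT.
  rewrite -(subrK i y); apply: ID => //; apply: MaI => /=.
  by rewrite mulrBl ya addrK.
Qed.

(* The library only multiplies in quotients of commutative rings, so we add the
   ring structure to its additive quotient by the two-sided ideal J(R). *)
Definition jacobson_quot : Type := {ideal_quot in_jacobson}.

HB.instance Definition _ := GRing.Zmodule.on jacobson_quot.
HB.instance Definition _ :=
  EqQuotient.copy jacobson_quot {ideal_quot in_jacobson}.

Definition jacobson_quot_one : jacobson_quot := \pi_jacobson_quot 1.
Definition jacobson_quot_mul := lift_op2 jacobson_quot *%R.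

Lemma jacobson_quot_eqE (x y : R) :
  (\pi_jacobson_quot x == \pi_jacobson_quot y) = (x - y \in in_jacobson).
Proof. by rewrite -Quotient.idealrBE. Qed.

Lemma pi_jacobson_quot_add (x y : R) :
  \pi_jacobson_quot (x + y) = \pi_jacobson_quot x + \pi_jacobson_quot y.
Proof. exact: Quotient.pi_add. Qed.

Lemma pi_jacobson_quot_mul (x y : R) :
  \pi_jacobson_quot (x * y)
  = jacobson_quot_mul (\pi_jacobson_quot x) (\pi_jacobson_quot y).
Proof.
set p := \pi_jacobson_quot x; set q := \pi_jacobson_quot y.
unlock jacobson_quot_mul; apply/eqP; rewrite jacobson_quot_eqE.
have -> : x * y - repr p * repr q = (x - repr p) * y + repr p * (y - repr q).
  by rewrite mulrBl mulrBr addrA subrK.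
by apply: rpredD; [apply: jacobsonMr | apply: jacobsonMl];
  rewrite -jacobson_quot_eqE reprK eqxx.
Qed.

Fact jacobson_quot_mulA : associative jacobson_quot_mul.
Proof.
move=> x y z; rewrite -[x]reprK -[y]reprK -[z]reprK.
by rewrite -!pi_jacobson_quot_mul mulrA.
Qed.

Fact jacobson_quot_mul1 : left_id jacobson_quot_one jacobson_quot_mul.
Proof. by move=> x; rewrite -[x]reprK /jacobson_quot_one -pi_jacobson_quot_mul mul1r. Qed.

Fact jacobson_quot_mulr1 : right_id jacobson_quot_one jacobson_quot_mul.
Proof. by move=> x; rewrite -[x]reprK /jacobson_quot_one -pi_jacobson_quot_mul mulr1. Qed.

Fact jacobson_quot_mulDl : left_distributive jacobson_quot_mul +%R.
Proof.
move=> x y z; rewrite -[x]reprK -[y]reprK -[z]reprK.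
by rewrite -!(pi_jacobson_quot_add, pi_jacobson_quot_mul) mulrDl.
Qed.

Fact jacobson_quot_mulDr : right_distributive jacobson_quot_mul +%R.
Proof.
move=> x y z; rewrite -[x]reprK -[y]reprK -[z]reprK.
by rewrite -!(pi_jacobson_quot_add, pi_jacobson_quot_mul) mulrDr.
Qed.

HB.instance Definition _ := GRing.Zmodule_isPzRing.Build jacobson_quot
  jacobson_quot_mulA jacobson_quot_mul1 jacobson_quot_mulr1
  jacobson_quot_mulDl jacobson_quot_mulDr.

End JacobsonRadical.

Arguments jacobson R : clear implicits.
Arguments in_jacobson R : clear implicits.

(* Main.v *)
Require Import Defs.
From mathcomp Require Import all_boot all_algebra.
From mathcomp Require Import boolp classical_sets.

(** A ring that is uniquely D-nil-clean but not a D-ring has a nontrivial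
    idempotent [e].  For [x = e r (1 - e)] the decompositions [e = 0 + e] and
    [e = - x + (e + x)] force [x = 0], so idempotents are central.  Everything
    in [eR] and in [(1 - e)R] is then a zero-divisor, so the two corners, hence
    [R] itself, are nil-clean.  In an abelian nil-clean ring [R] each nilpotent
    lies in [J(R)], each [r - r^2] is nilpotent, and [2] is nilpotent, so that
    every [1 + n] with [n] nilpotent has finite multiplicative order.
    Conversely, periodicity makes [J(R)] nil and some power of [a] an
    idempotent, which is congruent to [a] modulo [J(R)]. *)

Set Implicit Arguments.
Unset Strict Implicit.
Unset Printing Implicit Defensive.

Import GRing.Theory.
Local Open Scope ring_scope.
Local Open Scope quotient_scope.
Local Open Scope classical_set_scope.

(** * Nilpotents, idempotents and zero-divisors *)

Section Nilpotents.
Variable R : pzRingType.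
Implicit Types a e f n m r x y z : R.

Lemma nilpotent0 : nilpotent_elem (0 : R).
Proof. by exists 1%N; rewrite expr1. Qed.

Lemma nilpotentN x : nilpotent_elem x -> nilpotent_elem (- x).
Proof. by move=> [k xk]; exists k; rewrite exprNn xk mulr0. Qed.

Lemma nilpotentM_comm x y :
  GRing.comm x y -> nilpotent_elem x -> nilpotent_elem (x * y).
Proof. by move=> xy [k xk]; exists k; rewrite exprMn_comm // xk mul0r. Qed.

Lemma nilpotent_inv1B x : nilpotent_elem x ->
  exists2 v, v * (1 - x) = 1 & (1 - x) * v = 1.
Proof.
move=> [k xk]; pose s := \sum_(i < k) x ^+ i.
have s_r : (1 - x) * s = 1.
  by apply: oppr_inj; rewrite -mulNr opprB -subrX1 xk sub0r.
exists s => //; rewrite -{2}s_r.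
have xs : GRing.comm x s by apply: commr_sum => i _; exact/commrX/commr_refl.
by rewrite mulrBr mulrBl mulr1 mul1r xs.
Qed.

Lemma nilpotent_inv1D x : nilpotent_elem x ->
  exists2 v, v * (1 + x) = 1 & (1 + x) * v = 1.
Proof. by move=> /nilpotentN/nilpotent_inv1B; rewrite opprK. Qed.

(** As [e] commutes with [x], the relation iterates to [y ^+ j * x ^+ j * e = e], and some [x ^+ j]
    is zero. *)
Lemma nilpotent_lreg_eq0 x y e :
  GRing.comm e x -> nilpotent_elem x -> y * x * e = e -> e = 0.
Proof.
move=> ex [k xk] yxe.
suff /(_ k) <- : forall j, y ^+ j * x ^+ j * e = e by rewrite xk mulr0 mul0r.
elim=> [|j IH]; first by rewrite !mul1r.
have exj : e * x ^+ j = x ^+ j * e by exact: commrX.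
rewrite exprSr exprS -!mulrA -exj (mulrA x) (mulrA y) (mulrA y) yxe exj mulrA.
exact: IH.
Qed.

Lemma linv_not_zero_divisor a v : v * a = 1 -> ~ zero_divisor a.
Proof.
move=> va [b [c [b0 _ ab0 _]]]; move/eqP: b0; apply.
by rewrite -[b]mul1r -va -mulrA ab0 mulr0.
Qed.

Lemma idempotentB1 e : idempotent_elem e -> idempotent_elem (1 - e).
Proof.
move=> ee; rewrite /idempotent_elem mulrBr mulr1 mulrBl mul1r ee.
by rewrite subrr subr0.
Qed.

Lemma idempotent_mulB1 e : idempotent_elem e -> e * (1 - e) = 0.
Proof. by move=> ee; rewrite mulrBr mulr1 ee subrr. Qed.

Lemma idempotent_mul1B e : idempotent_elem e -> (1 - e) * e = 0.
Proof. by move=> ee; rewrite mulrBl mul1r ee subrr. Qed.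

Lemma idempotent_expr e k : idempotent_elem e -> e ^+ k.+1 = e.
Proof. by move=> ee; elim: k => // k IH; rewrite exprS IH ee. Qed.

Lemma nilpotent_idempotent0 e :
  idempotent_elem e -> nilpotent_elem e -> e = 0.
Proof.
by move=> ee [k ek]; rewrite -(idempotent_expr k ee) exprS ek mulr0.
Qed.

Lemma zero_divisor_idempotent e :
  idempotent_elem e -> e <> 0 -> e <> 1 -> zero_divisor e.
Proof.
move=> ee /eqP e0 e1; have e10 : 1 - e != 0.
  by rewrite subr_eq0; apply/eqP => /esym.
exists (1 - e), (1 - e); split => //.
- exact: idempotent_mulB1.
- exact: idempotent_mul1B.
Qed.

Lemma zero_divisor_corner e x :
    idempotent_elem e -> e <> 1 -> GRing.comm e x ->
  zero_divisor (e * x).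
Proof.
move=> ee e1 ex; have e10 : 1 - e != 0.
  by rewrite subr_eq0; apply/eqP => /esym.
exists (1 - e), (1 - e); split => //.
- by rewrite ex -mulrA idempotent_mulB1 // mulr0.
- by rewrite mulrA idempotent_mul1B // mul0r.
Qed.

End Nilpotents.

(** * Uniqueness of nil-clean decompositions in abelian rings *)

Section AbelianRings.
Variable R : pzRingType.
Hypothesis abR : abelian_ring R.
Implicit Types a e f n m r x y z : R.

(** Multiplying [n + e = m + f] by [g = e * (1 - f)], where [e * g = g] and [f * g = 0], gives
    [(1 + n) * g = m * g]. With [1 + n] invertible and [m] nilpotent, [g] vanishes. *)
Lemma abelian_nil_clean_le n m e f :
    nilpotent_elem n -> nilpotent_elem m ->
    idempotent_elem e -> idempotent_elem f -> n + e = m + f ->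
  e = e * f.
Proof.
move=> nn nm ee ff nemf; apply/eqP; rewrite -subr_eq0; apply/eqP.
set g := _ - _; have gE : g = e * (1 - f) by rewrite mulrBr mulr1.
have [v vn _] := nilpotent_inv1D nn.
have gm : GRing.comm g m.
  rewrite gE; apply/commr_sym/commrM; first exact/commr_sym/abR.
  exact/commr_sym/abR/idempotentB1.
apply: (nilpotent_lreg_eq0 (y := v) gm nm).
have eg : e * g = g by rewrite gE mulrA ee.
have fg : f * g = 0 by rewrite gE mulrA (abR ff) -mulrA idempotent_mulB1 ?mulr0.
suff mg : m * g = (1 + n) * g by rewrite -mulrA mg mulrA vn mul1r.
by rewrite mulrDl mul1r -{2}eg addrC -mulrDl nemf mulrDl fg addr0.
Qed.

Lemma abelian_nil_clean_unique n m e f :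
    nilpotent_elem n -> nilpotent_elem m ->
    idempotent_elem e -> idempotent_elem f -> n + e = m + f ->
  e = f.
Proof.
move=> nn nm ee ff nemf.
rewrite (abelian_nil_clean_le nn nm ee ff nemf) (abR ee).
by rewrite -(abelian_nil_clean_le nm nn ff ee (esym nemf)).
Qed.

End AbelianRings.

(** * The Jacobson radical through left inverses *)

Section Jacobson.
Variable R : pzRingType.
Implicit Types a e f n m r x y z : R.
Implicit Types I L M : set R.

Lemma left_ideal_eqT I : left_ideal I -> I 1 -> I = setT.
Proof.
move=> [_ _ IM] I1; apply/seteqP; split=> // x _.
by rewrite -[x]mulr1; exact: IM.
Qed.

Lemma proper_left_ideal_sub_maximal L : left_ideal L -> ~ L 1 ->
  exists2 M, maximal_left_ideal M & L `<=` M.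
Proof.
move=> idL L1.
(* Sets are taken modulo [L], so that the empty chain needs no special case. *)
pose P := [set A : set R | left_ideal (L `|` A) /\ ~ (L `|` A) 1].
have P0 : P set0 by split; rewrite setU0.
have [|A [[idA A1] Amax]] := @Zorn_bigcup R P.
  move=> F FP totF; pose U := L `|` \bigcup_(X in F) X.
  have UP x : U x -> exists A, [/\ A = set0 \/ F A & (L `|` A) x].
    case=> [Lx|[A FA Ax]]; first by exists set0; split; left.
    by exists A; split; right.
  have sU A : A = set0 \/ F A -> P A /\ L `|` A `<=` U.
    case=> [->|FA]; first by split=> // x [] // Lx; left.
    split; first exact: FP.
    by move=> x [Lx|Ax]; [left | right; exists A].
  (* The chain puts any two points of [U] in a single left ideal, where closure can be checked. *)
  have UP2 x y : U x -> U y ->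
      exists A, [/\ P A, L `|` A `<=` U, (L `|` A) x & (L `|` A) y].
    move=> /UP[A [FA Ax]] /UP[B [FB By]].
    have [PA AU] := sU _ FA; have [PB BU] := sU _ FB.
    have [AB|BA] : (A `<=` B) \/ (B `<=` A).
    - have [->|FA'] := FA; first by left.
      have [->|FB'] := FB; first by right.
      exact: totF.
    - by exists B; split => //; exact: (setUS AB).
    - by exists A; split => //; exact: (setUS BA).
  split.
    split.
    - by left; case: idL.
    - move=> x y Ux Uy; have [A [[[_ AD _] _] AU Ax Ay]] := UP2 _ _ Ux Uy.
      by apply: AU; exact: AD.
    - move=> a x Ux; have [A [[[_ _ AM] _] AU Ax _]] := UP2 _ _ Ux Ux.
      by apply: AU; exact: AM.
  by move=> U1; have [A [[_ A1] _ /A1]] := UP2 _ _ U1 U1.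
exists (L `|` A); last by move=> x Lx; left.
split=> //; first by move=> MT; apply: A1; rewrite MT.
move=> I idI LAI; have [I1|I1] := pselect (I 1).
  by right; exact: left_ideal_eqT.
left; apply/seteqP; split=> // x Ix; right; apply: contrapT => Ax.
(* [I] absorbs [L], hence belongs to [P]; the point [x] of [I] outside [A] then contradicts the
   maximality of [A]. *)
have LI : L `|` I = I.
  by apply/seteqP; split=> y; [case=> // Ly; apply: LAI; left | right].
apply: (Amax I); last by split; rewrite LI.
split; first by move=> y Ay; apply: LAI; right.
by move=> /(_ x Ix).
Qed.

(** Otherwise the left ideal generated by [1 - x] lies in a maximal one, which contains [x] too,
    hence [1]. *)
Lemma jacobson_linv1B x : x \in in_jacobson R -> exists v, v * (1 - x) = 1.
Proof.
move=> /in_jacobsonP Jx; apply: contrapT => nov.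
pose L := [set y | exists z, y = z * (1 - x)].
have idL : left_ideal L.
  split; first by exists 0; rewrite mul0r.
  - by move=> _ _ [y ->] [z ->]; exists (y + z); rewrite mulrDl.
  - by move=> a _ [y ->]; exists (a * y); rewrite mulrA.
have [[v v1]|M maxM LM] := proper_left_ideal_sub_maximal idL.
  by apply: nov; exists v.
have [idM MT _] := maxM; apply: MT; apply: left_ideal_eqT => //.
have [_ MD _] := idM; rewrite -(subrK x 1); apply: MD; last exact: Jx.
by apply: LM; exists 1; rewrite mul1r.
Qed.

(** If a maximal [M] misses [x], then [M + R x = R], so some [1 - r * x] lies in [M]; being left
    invertible, it forces [M = R]. *)
Lemma linv1B_jacobson x :
  (forall r, exists v, v * (1 - r * x) = 1) -> x \in in_jacobson R.
Proof.
move=> qx; apply/in_jacobsonP => M [[M0 MD MM] MT Mmax].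
apply: contrapT => Mx.
pose I := [set y | exists2 m, M m & exists r, y = m + r * x].
have idI : left_ideal I.
  split; first by exists 0 => //; exists 0; rewrite mul0r addr0.
  - move=> _ _ [m Mm [r ->]] [m' Mm' [r' ->]].
    by exists (m + m'); [exact: MD | exists (r + r'); rewrite mulrDl addrACA].
  - move=> a _ [m Mm [r ->]]; exists (a * m); first exact: MM.
    by exists (a * r); rewrite mulrDr mulrA.
have MI : M `<=` I.
  by move=> m Mm; exists m => //; exists 0; rewrite mul0r addr0.
have [IM|IT] := Mmax I idI MI.
  apply: Mx; rewrite -IM; exists 0 => //.
  by exists 1; rewrite mul1r add0r.
have [m Mm [r m1]] : I 1 by rewrite IT.
have [v v1] := qx r; apply: MT; apply: left_ideal_eqT => //.
by rewrite -v1 m1 addrK; exact: MM.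
Qed.

Lemma boolean_jacobson_quotP :
  boolean_ring (jacobson_quot R) <->
  forall x, x - x * x \in in_jacobson R.
Proof.
split=> [bool_RJ x | RJ q].
  rewrite -jacobson_quot_eqE pi_jacobson_quot_mul; apply/eqP/esym.
  exact: (bool_RJ (\pi_(jacobson_quot R) x)).
rewrite /idempotent_elem -[q]reprK; apply/esym/eqP.
rewrite (_ : (_ * _)%R = \pi_(jacobson_quot R) (repr q * repr q)).
  by rewrite jacobson_quot_eqE.
exact/esym/pi_jacobson_quot_mul.
Qed.

End Jacobson.

(** * Powers and the radical in periodic rings *)

Section PeriodicRings.
Variable R : pzRingType.
Hypothesis perR : periodic_ring R.
Implicit Types a e f n m r x y z : R.

Lemma periodic_shift a :
  exists i d : nat, (0 < d)%N /\ a ^+ i = a ^+ (i + d).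
Proof.
have [i [j [/eqP]]] := perR a; rewrite neq_ltn => /orP[] ij aij.
- by exists i, (j - i)%N; rewrite subn_gt0 ij subnKC ?(ltnW ij).
- by exists j, (i - j)%N; rewrite subn_gt0 ij subnKC ?(ltnW ij).
Qed.

Lemma periodic_idempotent_expr a : exists k, idempotent_elem (a ^+ k.+1).
Proof.
have [i [d [d0 ad]]] := periodic_shift a.
have step j : (i <= j)%N -> a ^+ (j + d) = a ^+ j.
  by move=> ij; rewrite -(subnK ij) -addnA exprD -ad -exprD.
have aiD j k : (i <= j)%N -> a ^+ (j + k * d) = a ^+ j.
  move=> ij; elim: k => [|k IH]; first by rewrite addn0.
  by rewrite mulSnr addnA step // (leq_trans ij) // leq_addr.
(* The exponent [i.+1 * d] is a multiple of the period and at least [i], so doubling it leaves the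
   power unchanged; [i.+1] keeps it positive when [i = 0]. *)
exists (i.+1 * d).-1; have d1 : (0 < i.+1 * d)%N by rewrite muln_gt0.
rewrite prednK // /idempotent_elem -exprD aiD //.
by rewrite (leq_trans (leqnSn i)) // leq_pmulr.
Qed.

(** Periodicity makes some [1 - x ^+ d.+1] kill a power of [x], and this factor is left
    invertible. *)
Lemma periodic_jacobson_nil x : x \in in_jacobson R -> nilpotent_elem x.
Proof.
move=> Jx; have [i [[|d] [// _ xd]]] := periodic_shift x.
have [|v v1] := @jacobson_linv1B R (x ^+ d.+1).
  by rewrite exprSr; exact: jacobsonMl.
exists i; rewrite -[x ^+ i]mul1r -v1 -mulrA mulrBl mul1r -exprD addnC -xd.
by rewrite subrr mulr0.
Qed.

End PeriodicRings.

(** * Finite order of unipotents *)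

Section Unipotents.
Variable R : pzRingType.
Implicit Types n x y z : R.

(** Binomial expansion with a second-order remainder; commutation of [z] with [y] lets powers of
    [y ^+ 2 * z] split. *)
Lemma exprD1n_quadratic y q :
  exists2 z, GRing.comm y z & (1 + y) ^+ q = 1 + y *+ q + y ^+ 2 * z.
Proof.
elim: q => [|q [z yz IH]].
  by exists 0; [exact: commr0 | rewrite mulr0n mulr0 !addr0].
exists (q%:R + z + z * y).
  apply: commrD; first by apply: commrD => //; exact: commr_nat.
  exact/commrM.
rewrite exprSr IH mulrDr mulr1 !mulrDl mul1r mulrSr.
rewrite mulrnAl -expr2 !mulrDr mulr_natr mulrA.
rewrite -!addrA; congr (_ + (_ + _)).
by rewrite addrCA; congr (_ + _); rewrite addrCA.
Qed.

Lemma unipotent_order q n : (0 < q)%N -> q%:R = 0 :> R -> nilpotent_elem n ->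
  exists2 m, (0 < m)%N & (1 + n) ^+ m = 1.
Proof.
move=> q0 qR [k nk].
(* The exponent is raised to a power of two because [(1 + n) ^+ q = 1 + n ^+ 2 * z] when [q = 0] in
   [R], and passing from [n] to [n ^+ 2 * z] halves it. *)
have nt : n ^+ (2 ^ k) = 0.
  by rewrite -(subnK (ltnW (ltn_expl k (ltnSn 1)))) exprD nk mulr0.
elim: k n {nk} nt => [|t IH] n nt.
  by exists 1%N; rewrite // -[n]expr1 nt addr0 expr1n.
have [z nz nq] := exprD1n_quadratic n q.
have /IH[m m0 m1] : (n ^+ 2 * z) ^+ (2 ^ t) = 0.
  rewrite exprMn_comm; last exact/commr_sym/commrX/commr_sym.
  by rewrite -exprM -expnS nt mul0r.
exists (q * m)%N; first by rewrite muln_gt0 q0.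
by rewrite exprM nq -mulr_natr qR mulr0 addr0.
Qed.

End Unipotents.

(** * Abelian nil-clean rings *)

Section AbelianNilCleanRings.
Variable R : pzRingType.
Hypothesis abR : abelian_ring R.
Hypothesis ncR : forall r : R, exists n f : R,
  [/\ nilpotent_elem n, idempotent_elem f & r = n + f].
Implicit Types e f n r x : R.

(** If [r * x = n + f], multiplying by [f] gives [r * x * f = (1 + n) * f]. As [x] is nilpotent and
    [1 + n] invertible, [f = 0], so [1 - r * x = 1 - n] is invertible. *)
Lemma nil_clean_nilpotent_jacobson x :
  nilpotent_elem x -> x \in in_jacobson R.
Proof.
move=> nx; apply: linv1B_jacobson => r; have [n [f [nn ff rx]]] := ncR (r * x).
suff f0 : f = 0.
  by have [v] := nilpotent_inv1B nn; exists v; rewrite rx f0 addr0.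
have [v v1 _] := nilpotent_inv1D nn.
apply: (nilpotent_lreg_eq0 (y := v * r) (abR ff x) nx).
rewrite -(mulrA v) rx -mulrA mulrDl ff -{2}[f]mul1r -mulrDl addrC mulrA.
by rewrite v1 mul1r.
Qed.

Lemma nil_clean_subr_sqr r : nilpotent_elem (r - r * r).
Proof.
have [n [f [nn ff ->]]] := ncR r; have fn := abR ff n.
have -> : n + f - (n + f) * (n + f) = n * (1 - n - f *+ 2).
  rewrite !mulrBr mulr1 mulrnAr mulr2n mulrDl !mulrDr ff fn !addrA.
  by rewrite opprD addrACA subrr addr0 -[in RHS](addrA n) -opprD addrA.
apply: nilpotentM_comm nn; apply: commrB.
  by apply: commrB; [exact: commr1 | exact: commr_refl].
exact/commrMn/commr_sym.
Qed.

Lemma nil_clean_boolean_jacobson_quot : boolean_ring (jacobson_quot R).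
Proof.
apply/boolean_jacobson_quotP => x.
exact/nil_clean_nilpotent_jacobson/nil_clean_subr_sqr.
Qed.

(** For [r = 2], the nilpotent [r - r * r] is [- 2], so a power of [2] vanishes. *)
Lemma nil_clean_char : exists2 q, (0 < q)%N & q%:R = 0 :> R.
Proof.
have [k] := nilpotentN (nil_clean_subr_sqr 2%:R).
rewrite -natrM opprB -natrB // -natrX => k0.
by exists ((2 * 2 - 2) ^ k)%N; rewrite ?expn_gt0.
Qed.

Lemma nil_clean_periodic : periodic_ring R.
Proof.
move=> r; have [n [f [nn ff ->]]] := ncR r.
have [q q0 qR] := nil_clean_char; have [m m0 m1] := unipotent_order q0 qR nn.
(* On the corner of [f] the element acts as the unipotent [1 + n], of finite order; on that of
   [1 - f] it acts as the nilpotent [n]. *)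
have exprE k : (n + f) ^+ k = (1 + n) ^+ k * f + n ^+ k * (1 - f).
  elim: k => [|k IH]; first by rewrite !expr0 !mul1r addrC subrK.
  have fE : (n + f) * f = (1 + n) * f by rewrite !mulrDl ff mul1r addrC.
  have f1 : (n + f) * (1 - f) = n * (1 - f).
    by rewrite mulrDl idempotent_mulB1 // addr0.
  rewrite exprS IH mulrDr -(abR ff) -(abR (idempotentB1 ff)) !mulrA fE f1.
  by rewrite -!mulrA (abR ff) (abR (idempotentB1 ff)) !mulrA -!exprS.
have [k nk] := nn; exists k, (k + m)%N; split.
  by apply/eqP; rewrite neq_ltn -{1}[k]addn0 ltn_add2l m0.
by rewrite !exprE !exprD nk m1 mulr1 !mul0r.
Qed.

End AbelianNilCleanRings.

(** * The two directions of the equivalence *)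

Section UniquelyDNilClean.
Variable R : pzRingType.
Implicit Types a e f n r x : R.

(** In any decomposition the idempotent is [0]: a nontrivial one would be a zero-divisor, hence
    nilpotent, and [1] would make [a] invertible. *)
Lemma D_ring_uniquely_D_nil_clean : D_ring R -> uniquely_D_nil_clean R.
Proof.
move=> DR a zda; exists (a, 0); split.
  by split=> /=; [exact: DR | exact: mulr0 | rewrite addr0].
move=> [n e] /= [nn ee ane]; suff e0 : e = 0 by rewrite ane e0 addr0.
apply: contrapT => e0; have [e1|e1] := pselect (e = 1); last first.
  exact/e0/(nilpotent_idempotent0 ee)/DR/zero_divisor_idempotent.
have [v va _] := nilpotent_inv1D nn.
by apply: (linv_not_zero_divisor (v := v) _ zda); rewrite ane e1 addrC.
Qed.

Lemma abelian_periodic_uniquely_D_nil_clean :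
    abelian_ring R -> periodic_ring R -> boolean_ring (jacobson_quot R) ->
  uniquely_D_nil_clean R.
Proof.
move=> abR perR /boolean_jacobson_quotP RJ a _.
have [k idk] := periodic_idempotent_expr perR a.
(* Since the radical is nil here, this makes [a - a ^+ k.+1] the nilpotent part. *)
have Jk j : a - a ^+ j.+1 \in in_jacobson R.
  elim: j => [|j IH]; first by rewrite subrr rpred0.
  have -> : a - a ^+ j.+2 = (a - a * a) + a * (a - a ^+ j.+1).
    by rewrite mulrBr addrA subrK -exprS.
  by apply: rpredD; [exact: RJ | exact: jacobsonMl].
have nk := periodic_jacobson_nil perR (Jk k).
exists (a - a ^+ k.+1, a ^+ k.+1); split; first by split; rewrite //= subrK.
move=> [n e] /= [nn ee ane].
have <- : e = a ^+ k.+1.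
  by apply: (abelian_nil_clean_unique abR nn nk ee idk); rewrite subrK.
by congr (_, _); rewrite ane addrK.
Qed.

Hypothesis uR : uniquely_D_nil_clean R.

(** The condition [e * x + x * e = x] covers both off-diagonal Peirce corners of [e], and with
    [x * x = 0] it makes [e + x] idempotent. *)
Lemma idempotent_perturbation_eq0 e x :
    zero_divisor e -> idempotent_elem e -> x * x = 0 -> e * x + x * e = x ->
  x = 0.
Proof.
move=> /uR [p [_ pu]] ee xx exe.
have p0 : p = (0, e).
  by apply: pu; split=> //=; [exact: nilpotent0 | rewrite add0r].
have px : p = (- x, e + x).
  apply: pu; split=> /=; last by rewrite addrC addrK.
  - by apply: nilpotentN; exists 2; rewrite expr2.
  - by rewrite /idempotent_elem mulrDl !mulrDr ee xx addr0 -addrA exe.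
by move: px; rewrite p0 => -[/eqP]; rewrite eq_sym oppr_eq0 => /eqP.
Qed.

Lemma uniquely_D_nil_clean_abelian : abelian_ring R.
Proof.
move=> e ee r.
have [->|e0] := pselect (e = 0); first exact/commr_sym/commr0.
have [->|e1] := pselect (e = 1); first exact/commr_sym/commr1.
have zde := zero_divisor_idempotent ee e0 e1.
have er1 : e * r * (1 - e) = 0.
  apply: (idempotent_perturbation_eq0 zde ee).
    by rewrite -!mulrA (mulrA (1 - e) e) idempotent_mul1B // mul0r !mulr0.
  by rewrite !mulrA ee -(mulrA _ (1 - e)) idempotent_mul1B // mulr0 addr0.
have r1e : (1 - e) * r * e = 0.
  apply: (idempotent_perturbation_eq0 zde ee).
    by rewrite -!mulrA (mulrA e (1 - e)) idempotent_mulB1 // mul0r !mulr0.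
  by rewrite !mulrA idempotent_mulB1 // !mul0r add0r -(mulrA _ e e) ee.
have ere : e * r * e = e * r.
  by apply/esym/eqP; rewrite -subr_eq0 -{1}[e * r]mulr1 -mulrBr er1.
rewrite /GRing.comm -ere; apply/esym/eqP.
by rewrite -subr_eq0 -{1}[r]mul1r -!mulrA -mulrBl mulrA r1e.
Qed.

Lemma uniquely_D_nil_clean_nil_clean : ~ D_ring R ->
  forall r, exists n f,
    [/\ nilpotent_elem n, idempotent_elem f & r = n + f].
Proof.
move=> nD; have abR := uniquely_D_nil_clean_abelian.
(* The idempotent part of a non-nilpotent zero-divisor is neither [0] nor [1]. *)
have [e [ee e0 e1]] : exists e, [/\ idempotent_elem e, e <> 0 & e <> 1].
  apply: contrapT => noe; apply: nD => a zda.
  have [[n e] [[/= nn ee ane] _]] := uR zda.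
  have [e0|e0] := pselect (e = 0); first by rewrite ane e0 addr0.
  have [e1|e1] := pselect (e = 1); last by case: noe; exists e.
  have [v va _] := nilpotent_inv1D nn.
  have /linv_not_zero_divisor/(_ zda)[] : v * a = 1 by rewrite ane e1 addrC.
move=> r; have ee' := idempotentB1 ee.
have e1' : 1 - e <> 1.
  by move=> /eqP; rewrite subr_eq addrC -subr_eq subrr eq_sym => /eqP.
have [[n f] [[/= nn ff nf] _]] := uR (zero_divisor_corner ee e1 (abR _ ee r)).
have [[m g] [[/= nm gg mg] _]] := uR (zero_divisor_corner ee' e1' (abR _ ee' r)).
have ee1 := idempotent_mulB1 ee; have e1e := idempotent_mul1B ee.
(* Multiplication is componentwise in the product of the two corners. *)
have cM x y z t : (e * x + (1 - e) * y) * (e * z + (1 - e) * t) =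
    e * (x * z) + (1 - e) * (y * t).
  rewrite mulrDl !mulrDr (abR _ ee x) (abR _ ee' y) -!mulrA.
  rewrite !(mulrA e e, mulrA e (1 - e), mulrA (1 - e) e, mulrA (1 - e) (1 - e)).
  rewrite ee ee' ee1 e1e !mul0r !mulr0 addr0 add0r.
  by rewrite (mulrA x) -(abR _ ee x) (mulrA y) -(abR _ ee' y) !mulrA.
(* The parts found for [e * r] and [(1 - e) * r] need not lie in the corners, so each is projected
   before being added. *)
exists (e * n + (1 - e) * m), (e * f + (1 - e) * g); split.
- have [k nk] := nn; have [l ml] := nm; exists (k + l)%N.
  have -> j : (e * n + (1 - e) * m) ^+ j = e * n ^+ j + (1 - e) * m ^+ j.
    elim: j => [|j IH]; first by rewrite !expr0 !mulr1 addrC subrK.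
    by rewrite exprS IH cM -!exprS.
  by rewrite !exprD nk ml mul0r !mulr0 addr0.
- by rewrite /idempotent_elem cM ff gg.
- rewrite addrACA -!mulrDr -nf -mg !mulrA ee ee' -mulrDl addrC subrK.
  by rewrite mul1r.
Qed.

End UniquelyDNilClean.

Theorem theorem4p4 (R : pzRingType) :
  uniquely_D_nil_clean R <->
  (D_ring R \/
   (abelian_ring R /\ periodic_ring R /\ boolean_ring (jacobson_quot R))).
Proof.
split=> [uR | [DR | [abR [perR boolRJ]]]].
- have [DR|nD] := pselect (D_ring R); [by left | right].
  have abR := uniquely_D_nil_clean_abelian uR.
  have ncR := uniquely_D_nil_clean_nil_clean uR nD.
  split=> //; split; first exact: nil_clean_periodic.
  exact: nil_clean_boolean_jacobson_quot.
- exact: D_ring_uniquely_D_nil_clean.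
- exact: abelian_periodic_uniquely_D_nil_clean.
Qed.
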